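(* The logic $\mathbf{\Lambda}_t$ of implicative posets is sound and complete in the class $\mathbb{PU}$ of frames: for all sentences $\varphi,\psi$, the sequent $\varphi\vdash\psi$ is provable in $\mathbf{\Lambda}_t$ if and only if $[\![\varphi]\!]_{\mathfrak{M}}\subseteq[\![\psi]\!]_{\mathfrak{M}}$ for every model $\mathfrak{M}=(\mathfrak{F},V)$ on a frame $\mathfrak{F}\in\mathbb{PU}$.
   Context: Logic. Sentences: $\varphi::=p_i\,(i\in\mathbb{N})\mid\top\mid\mathtt{t}\mid\varphi\to\varphi$. $\mathbf{\Lambda}_t$ is the set of sequents $\varphi\vdash\psi$ generated by: $\varphi\vdash\varphi$; $\varphi\vdash\top$; cut (from $\varphi\vdash\psi$, $\psi\vdash\vartheta$ infer $\varphi\vdash\vartheta$); uniform substitution; the two-way rule $\varphi\vdash\psi$ iff $\mathtt{t}\vdash\varphi\to\psi$; from $\psi\vdash\vartheta$ infer $\varphi\to\psi\vdash\varphi\to\vartheta$ and $\vartheta\to\varphi\vdash\psi\to\varphi$. ($\vdash\varphi$ abbreviates $\mathtt{t}\vdash\varphi$.) Frames. $\mathfrak{F}=(W_1,W_\partial,I,U,T)$: $W_1,W_\partial$ nonempty sets (not necessarily disjoint), $I\subseteq W_1\times W_\partial$, $U\subseteq W_1$, $T\subseteq W_\partial\times(W_1\times W_\partial)$. Let $\perp$ be the complement of $I$. For $A\subseteq W_1$, $A'=\{y\in W_\partial\mid\forall x\in A\;x\perp y\}$; for $B\subseteq W_\partial$, $B'=\{x\in W_1\mid\forall y\in B\;x\perp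 y\}$. Galois sets are the subsets $G$ of $W_1$ (stable) or $W_\partial$ (co-stable) with $G=G''$. $Txv=\{y\in W_\partial\mid yTxv\}$; the Galois dual $T'$ of $T$ is given by $uT'xv$ iff $u\in(Txv)'$, for $u,x\in W_1,v\in W_\partial$. $\mathbb{PU}$ is the class of frames satisfying: (F1) for all $x\in W_1,v\in W_\partial$, $Txv$ is a Galois set; (U) $U$ is Galois stable and for all $x\in W_1$, $v\in W_\partial$: $x\perp v$ iff for all $u\in U$, $uT'xv$. Models. A model $(\mathfrak{F},V)$ assigns to each $p_i$ a Galois stable set $V(p_i)\subseteq W_1$. Interpretation: $[\![p_i]\!]=V(p_i)$, $[\![\top]\!]=W_1$, $[\![\mathtt{t}]\!]=U$, and $[\![\varphi\to\psi]\!]=\{u\in W_1\mid\forall x\in[\![\varphi]\!]\,\forall v\in[\![\psi]\!]'\;\;uT'xv\}$. *)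

(* Defs.v *)
From mathcomp Require Import all_boot.
From mathcomp Require Import classical_sets.

Set Implicit Arguments.
Unset Strict Implicit.
Unset Printing Implicit Defensive.

Local Open Scope classical_set_scope.

Inductive sentence : Type :=
| Var of nat
| Top
| Tt (* the constant t, interpreted by the distinguished set U *)
| Imp of sentence & sentence.

Fixpoint subst (s : nat -> sentence) (phi : sentence) : sentence :=
  match phi with
  | Var i => s i
  | Top => Top
  | Tt => Tt
  | Imp phi psi => Imp (subst s phi) (subst s psi)
  end.

(* [provable phi psi] : the sequent phi |- psi belongs to Lambda_t *)
Inductive provable : sentence -> sentence -> Prop :=
| provable_refl phi : provable phi phi
| provable_top phi : provable phi Top
| provable_cut phi psi theta :
    provable phi psi -> provable psi theta -> provable phi theta
| provable_subst s phi psi :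
    provable phi psi -> provable (subst s phi) (subst s psi)
| provable_imp_intro phi psi :
    provable phi psi -> provable Tt (Imp phi psi)
| provable_imp_elim phi psi :
    provable Tt (Imp phi psi) -> provable phi psi
| provable_imp_monor phi psi theta :
    provable psi theta -> provable (Imp phi psi) (Imp phi theta)
| provable_imp_antil phi psi theta :
    provable psi theta -> provable (Imp theta phi) (Imp psi phi).

(* The two sorts are separate types: no part of the structure compares a point
   of [W1] with a point of [Wd], so whether the sorts overlap is immaterial. *)
Record frame : Type := Frame {
  W1 : Type;
  Wd : Type;
  W1_nonempty : inhabited W1;
  Wd_nonempty : inhabited Wd;
  incid : W1 -> Wd -> Prop;
  U : set W1;
  T : Wd -> W1 -> Wd -> Prop (* [T y x v] is y T x v *)
}.

Definition perp (F : frame) (x : W1 F) (y : Wd F) : Prop := ~ incid x y.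

(* The two halves A |-> A' and B |-> B' of the Galois connection of [perp] *)
Definition polar1 (F : frame) (A : set (W1 F)) : set (Wd F) :=
  [set y | forall x, A x -> perp x y].

Definition polard (F : frame) (B : set (Wd F)) : set (W1 F) :=
  [set x | forall y, B y -> perp x y].

Definition stable (F : frame) (A : set (W1 F)) : Prop :=
  A = polard (polar1 A).

Definition costable (F : frame) (B : set (Wd F)) : Prop :=
  B = polar1 (polard B).

Definition Tsec (F : frame) (x : W1 F) (v : Wd F) : set (Wd F) :=
  [set y | T y x v].

(* The Galois dual T' : [Tdual u x v] is u T' x v *)
Definition Tdual (F : frame) (u x : W1 F) (v : Wd F) : Prop :=
  polard (Tsec x v) u.

Record PU (F : frame) : Prop := {
  PU_F1 : forall (x : W1 F) (v : Wd F), costable (Tsec x v);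
  PU_U : stable (@U F) /\
    forall (x : W1 F) (v : Wd F),
      perp x v <-> forall u : W1 F, U u -> Tdual u x v
}.

Record model : Type := Model {
  model_frame : frame;
  valuation : nat -> set (W1 model_frame);
  valuation_stable : forall i : nat, stable (valuation i)
}.

Fixpoint interp (M : model) (phi : sentence) : set (W1 (model_frame M)) :=
  match phi with
  | Var i => valuation i
  | Top => setT
  | Tt => @U (model_frame M)
  | Imp phi psi =>
      [set u | forall x, interp phi x ->
               forall v, polar1 (interp psi) v -> Tdual u x v]
  end.

Arguments interp M phi : clear implicits.

(* Main.v *)
(** Soundness rests on [x T' v] being a residual of [perp] over [U], so that
    [U] is contained in [phi -> psi] exactly when [phi] is contained in [psi].
    For completeness, no filters or ideals are needed: both sorts of the
    canonical frame consist of the sentences themselves, with [x perp v] iff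
    [x |- v] and [y T x v] iff [x -> v |- y].  Then [u T' x v] iff
    [u |- x -> v], and every sentence denotes its principal down-set. *)
Require Import Defs.
From mathcomp Require Import all_boot.
From mathcomp Require Import boolp classical_sets.

Local Open Scope classical_set_scope.

Lemma polar1S (F : frame) (A B : set (W1 F)) :
  A `<=` B -> polar1 B `<=` polar1 A.
Proof. by move=> AB y By x /AB; apply: By. Qed.

Lemma stable_polard (F : frame) (B : set (Wd F)) : stable (polard B).
Proof.
apply/seteqP; split=> x Bx y; first exact.
by move=> By; apply: Bx => z; apply.
Qed.

Lemma costable_polar1 (F : frame) (A : set (W1 F)) : costable (polar1 A).
Proof.
apply/seteqP; split=> y Ay x; first exact.
by move=> Ax; apply: Ay => z; apply.
Qed.

Section Soundness.

(** An implication denotes the polar of the union of the sections [Tsec x v], for [x] in the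
    antecedent and [v] in the polar of the consequent. Every polar is stable, so a case analysis
    suffices. *)
Lemma interp_stable (M : model) (phi : sentence) :
  PU (model_frame M) -> stable (interp M phi).
Proof.
move=> [_ [stU _]]; case: phi => [i|||phi psi] //=.
- exact: valuation_stable.
- by apply/seteqP; split=> // x _ y; apply.
- rewrite [X in stable X](_ : _ = polard [set y | exists x v,
    [/\ interp M phi x, polar1 (interp M psi) v & T y x v]]).
    exact: stable_polard.
  apply/seteqP; split=> u Hu.
    by move=> y [x [v [Hx Hv]]]; apply: Hu.
  by move=> x Hx v Hv y Hy; apply: Hu; exists x, v.
Qed.

Lemma U_sub_interp_Imp (M : model) (phi psi : sentence) :
  PU (model_frame M) ->
  (@U (model_frame M) `<=` interp M (Imp phi psi)) <->
  (interp M phi `<=` interp M psi).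
Proof.
move=> FPU; have [_ [_ perpE]] := FPU; split=> [sub x Hx|sub u Uu x Hx v Hv].
  (* Stability of the consequent reduces membership to [perp x v] for all [v] in its polar. *)
  rewrite (interp_stable M psi FPU) => v Hv.
  by apply/perpE => u Uu; apply: sub Hx v Hv.
by move/perpE: (Hv x (sub x Hx)); apply.
Qed.

(** Substitution is absorbed into the valuation, which is admissible because denotations are
    stable. *)
Definition subst_model (M : model) (FPU : PU (model_frame M))
    (s : nat -> sentence) : model :=
  @Model (model_frame M) (fun i => interp M (s i))
    (fun i => interp_stable M (s i) FPU).

Lemma interp_subst (M : model) (FPU : PU (model_frame M))
    (s : nat -> sentence) (phi : sentence) :
  interp M (subst s phi) = interp (subst_model M FPU s) phi.
Proof. by elim: phi => //= phi -> psi ->. Qed.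

Lemma soundness (phi psi : sentence) :
  provable phi psi ->
  forall M : model, PU (model_frame M) -> interp M phi `<=` interp M psi.
Proof.
elim=> {phi psi} [phi|phi|phi psi theta _ IH1 _ IH2|s phi psi _ IH
  |phi psi _ IH|phi psi _ IH|phi psi theta _ IH|phi psi theta _ IH] M FPU //.
- exact: subset_trans (IH1 M FPU) (IH2 M FPU).
(* The induction hypothesis is used at another model on the same frame. *)
- by rewrite !(interp_subst M FPU); apply: (IH (subst_model M FPU s)).
- by apply/(U_sub_interp_Imp M phi psi FPU); apply: (IH M FPU).
- by apply/(U_sub_interp_Imp M phi psi FPU); apply: (IH M FPU).
- move=> u Hu x Hx v Hv; apply: Hu => //.
  exact: polar1S (IH M FPU) _ Hv.
- by move=> u Hu x Hx v Hv; apply: Hu => //; apply: (IH M FPU).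
Qed.

End Soundness.

Section Completeness.

Definition canonical_frame : frame :=
  @Frame sentence sentence (inhabits Tt) (inhabits Tt)
    (fun x v => ~ provable x v) [set u | provable u Tt]
    (fun y x v => provable (Imp x v) y).

Lemma canonical_perp (x v : sentence) :
  @perp canonical_frame x v <-> provable x v.
Proof. by rewrite /perp /= notK. Qed.

Lemma canonical_polard1 (phi : sentence) :
  @polard canonical_frame [set phi] = [set x | provable x phi].
Proof.
apply/seteqP; split=> x /=; first by move=> /(_ phi erefl) /canonical_perp.
by move=> Hx _ ->; apply/canonical_perp.
Qed.

Lemma canonical_polar1_down (phi : sentence) :
  @polar1 canonical_frame [set x | provable x phi]
  = [set v | provable phi v].
Proof.
apply/seteqP; split=> v /=.
  by move=> /(_ phi (provable_refl phi)) /canonical_perp.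
by move=> Hv x Hx; apply/canonical_perp; apply: provable_cut Hx Hv.
Qed.

Lemma canonical_stable (phi : sentence) :
  @stable canonical_frame [set x | provable x phi].
Proof. by rewrite -canonical_polard1; apply: stable_polard. Qed.

(** [Imp x v] is the least element of the section [Tsec x v], so being below the whole section
    amounts to being below it. *)
Lemma canonical_Tdual (u x v : sentence) :
  @Tdual canonical_frame u x v <-> provable u (Imp x v).
Proof.
split=> [/(_ _ (provable_refl _)) /canonical_perp //|Hu y Hy].
by apply/canonical_perp; apply: provable_cut Hu Hy.
Qed.

Lemma canonical_PU : PU canonical_frame.
Proof.
split=> [x v|].
  (* Each section is a principal up-set, hence the polar of a principal down-set. *)
  rewrite [X in costable X](_ : _ = [set y | provable (Imp x v) y]) //.
  by rewrite -canonical_polar1_down; apply: costable_polar1.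
split=> [|x v]; first exact: canonical_stable.
split=> [/canonical_perp xv u Uu|H].
  apply/canonical_Tdual; apply: provable_cut Uu _.
  exact: provable_imp_intro.
(* The two-way rule for [Tt] gives both directions of (U); here [H] is taken at [u := Tt]. *)
apply/canonical_perp/provable_imp_elim/canonical_Tdual.
exact: H (provable_refl _).
Qed.

Definition canonical_model : model :=
  @Model canonical_frame (fun i => [set x | provable x (Var i)])
    (fun i => canonical_stable (Var i)).

Lemma interp_canonical (phi : sentence) :
  interp canonical_model phi = [set x | provable x phi].
Proof.
elim: phi => [//||//|phi IHphi psi IHpsi] /=.
  by apply/seteqP; split=> // x _; apply: provable_top.
rewrite IHphi IHpsi canonical_polar1_down; apply/seteqP; split=> u /=.
  (* The extreme instances: [phi] is the greatest [x] and [psi] the least [v]. The converse follows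
     from the two monotonicity rules. *)
  move=> /(_ phi (provable_refl _) psi (provable_refl _)).
  by move/canonical_Tdual.
move=> Hu x Hx v Hv; apply/canonical_Tdual; apply: provable_cut Hu _.
exact: provable_cut (provable_imp_antil _ Hx) (provable_imp_monor _ Hv).
Qed.

Lemma completeness (phi psi : sentence) :
  (forall M : model, PU (model_frame M) -> interp M phi `<=` interp M psi) ->
  provable phi psi.
Proof.
move=> /(_ canonical_model canonical_PU); rewrite !interp_canonical.
(* The inclusion of down-sets is evaluated at [phi] itself. *)
by apply; apply: provable_refl.
Qed.

End Completeness.

Theorem theorem3p2 (phi psi : sentence) :
  provable phi psi <->
  forall M : model, PU (model_frame M) -> interp M phi `<=` interp M psi.
Proof. split; [exact: soundness | exact: completeness]. Qed.
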